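(* Let $1<p<\infty$, $p\neq2$, and let $Y$ be a closed subspace of co-dimension $n$ in the real Banach space $\ell_p$. Then $Y$ has property-$(SU)$ in $\ell_p$ if and only if there exists a basis $\{a^1,a^2,\dots,a^n\}$ for $Y^\perp$ such that every $a^i$, $1\le i\le n$, has at most two non-null components.
   Context: For a closed subspace $Y$ of a Banach space $X$, $Y^\perp=\{x^*\in X^*: x^*(y)=0\ \forall y\in Y\}$; for $X=\ell_p$, $Y^\perp$ is a subspace of $\ell_p^*=\ell_q$, $\frac1p+\frac1q=1$, and components refer to coordinates in $\ell_q$. $Y$ has property-$(SU)$ in $X$ if there is a closed subspace $G$ of $X^*$ with $X^*=G\oplus Y^\perp$ such that for each $x^*\in X^*$, $\|x^*\|>\|y^\#\|$ whenever $x^*=y^\#+y^\perp$ with $y^\#\in G$ and $0\neq y^\perp\in Y^\perp$. *)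

(* Defs.v *)
From HB Require Import structures.
From mathcomp Require Import all_boot all_order all_algebra.
From mathcomp Require Import all_classical all_reals all_analysis.
Set Implicit Arguments.
Unset Strict Implicit.
Unset Printing Implicit Defensive.
Import Order.TTheory GRing.Theory Num.Theory.
Import numFieldNormedType.Exports.
Local Open Scope classical_set_scope.
Local Open Scope ring_scope.

Section linear_subspaces.
Context {R : realType}.

Definition linear_subspace {V : lmodType R} (Y : set V) : Prop :=
  Y 0 /\ forall (a : R) (x y : V), Y x -> Y y -> Y (a *: x + y).

Definition closed_subspace {V : normedModType R} (Y : set V) : Prop :=
  closed Y /\ linear_subspace Y.

Definition is_basis {V : lmodType R} (W : set V) (n : nat) (a : 'I_n -> V) :
    Prop :=
  [/\ forall i, W (a i),
      forall c : 'I_n -> R, \sum_i c i *: a i = 0 -> forall i, c i = 0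
    & forall v, W v -> exists c : 'I_n -> R, v = \sum_i c i *: a i].

(* The cosets of v_0, ..., v_{n-1} form a basis of the quotient V / Y. *)
Definition has_codim {V : lmodType R} (Y : set V) (n : nat) : Prop :=
  exists v : 'I_n -> V,
    (forall c : 'I_n -> R, Y (\sum_i c i *: v i) -> forall i, c i = 0) /\
    (forall x, exists c : 'I_n -> R, Y (x - \sum_i c i *: v i)).

Definition direct_sum {V : lmodType R} (G H : set V) : Prop :=
  (forall x, G x -> H x -> x = 0) /\
  (forall x, exists g h, [/\ G g, H h & x = g + h]).

End linear_subspaces.

Section dual_space.
Context {R : realType} (X : normedModType R).

Definition dual_pred : {pred X -> R^o} :=
  mem [set f : X -> R^o | linear f /\ continuous f].

Record dual := Dual {
  dual_fun :> X -> R^o;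
  dual_funP : dual_fun \in dual_pred }.

HB.instance Definition _ := [isSub for dual_fun].
HB.instance Definition _ := [Choice of dual by <:].

Lemma dual_submod_closed : submod_closed dual_pred.
Proof.
split.
  rewrite inE /=; split; last exact: cst_continuous.
  by move=> a x y /=; rewrite scaler0 addr0.
move=> a f g; rewrite !inE /= => -[lf cf] [lg cg]; split.
  move=> b x y; rewrite /= [in LHS](_ : (a *: f + g) _ =
    a *: f (b *: x + y) + g (b *: x + y))//.
  rewrite lf lg !scalerDr !scalerA (mulrC b a) -!addrA.
  by congr (_ + _); rewrite addrCA.
move=> x; apply: (@continuousD _ _ _ (fun x => a *: f x)); last exact: cg.
by apply: continuousZr; exact: cf.
Qed.

HB.instance Definition _ :=
  GRing.isSubmodClosed.Build R (X -> R^o) dual_pred dual_submod_closed.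
HB.instance Definition _ := [SubChoice_isSubLmodule of dual by <:].

Lemma dual_linear (f : dual) : linear f.
Proof. by have := dual_funP f; rewrite inE => -[]. Qed.

HB.instance Definition _ (f : dual) :=
  GRing.isLinear.Build R X R^o _ (f : X -> R^o) (@dual_linear f).

Lemma dual_continuous (f : dual) : continuous f.
Proof. by have := dual_funP f; rewrite inE => -[]. Qed.

Definition opnorm (f : dual) : R :=
  sup [set `|f x| | x in [set x : X | `|x| <= 1]].

Lemma opnorm_has_sup (f : dual) :
  has_sup [set `|f x| | x in [set x : X | `|x| <= 1]].
Proof.
split; first by exists `|f 0|; exists 0 => //=; rewrite normr0.
have /linear_bounded_continuous/linear_boundedP := @dual_continuous f.
move=> /pinfty_ex_gt0[M M0 fM]; exists M => _ [x /= x1 <-].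
by rewrite (le_trans (fM x))// ler_piMr// ltW.
Qed.

Lemma opnorm_ge0 (f : dual) : 0 <= opnorm f.
Proof.
apply: le_trans (sup_upper_bound (opnorm_has_sup f) _); last first.
  by exists 0 => /=; [rewrite normr0|].
exact: normr_ge0.
Qed.

Lemma ler_opnorm (f : dual) (x : X) : `|f x| <= opnorm f * `|x|.
Proof.
have [->|x0] := eqVneq x 0; first by rewrite linear0 !normr0 mulr0.
have nx : 0 < `|x| by rewrite normr_gt0.
rewrite -ler_pdivrMr//; apply: (sup_upper_bound (opnorm_has_sup f)).
exists (`|x|^-1 *: x) => /=.
  by rewrite normrZ normfV normr_id mulVf// gt_eqF.
by rewrite linearZ /= normrZ normfV normr_id mulrC.
Qed.

Lemma opnorm_le (f : dual) (M : R) : 0 <= M ->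
  (forall x, `|f x| <= M * `|x|) -> opnorm f <= M.
Proof.
move=> M0 fM; apply: ge_sup; first by case: (opnorm_has_sup f).
by move=> _ [x /= x1 <-]; rewrite (le_trans (fM x))// ler_piMr.
Qed.

Lemma opnormD (f g : dual) : opnorm (f + g) <= opnorm f + opnorm g.
Proof.
apply: opnorm_le; first by rewrite addr_ge0 ?opnorm_ge0.
move=> x; rewrite mulrDl (le_trans (ler_normD (f x) (g x)))//.
by rewrite lerD// ler_opnorm.
Qed.

Lemma opnormZ (a : R) (f : dual) : opnorm (a *: f) = `|a| * opnorm f.
Proof.
have le b (g : dual) : opnorm (b *: g) <= `|b| * opnorm g.
  apply: opnorm_le; first by rewrite mulr_ge0 ?opnorm_ge0.
  move=> x; rewrite (_ : (b *: g) x = b *: g x)// normrZ -mulrA.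
  by rewrite ler_wpM2l// ler_opnorm.
apply/eqP; rewrite eq_le le /=.
have [->|a0] := eqVneq a 0; first by rewrite normr0 mul0r opnorm_ge0.
have := le a^-1 (a *: f); rewrite scalerA mulVf// scale1r normfV.
by rewrite ler_pdivlMl // normr_gt0.
Qed.

Lemma opnorm_eq0 (f : dual) : opnorm f = 0 -> f = 0.
Proof.
move=> f0; apply/val_inj/funext => x; apply/eqP.
by rewrite -normr_le0 (le_trans (ler_opnorm f x))// f0 mul0r.
Qed.

HB.instance Definition _ :=
  Lmodule_isNormed.Build R dual opnormD opnormZ opnorm_eq0.

Definition annihilator (Y : set X) : set dual :=
  [set f | forall y, Y y -> f y = 0].

Definition property_SU (Y : set X) : Prop :=
  exists G : set dual,
    [/\ closed_subspace G,
        direct_sum G (annihilator Y)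
      & forall f g h : dual, G g -> annihilator Y h -> h != 0 ->
          f = g + h -> `|g| < `|f|].

End dual_space.

Section ell_p.
Context {R : realType} (p : R) (p1 : 1 <= p).

Let p1e : (1 <= p%:E)%E. Proof. by rewrite lee_fin. Qed.

(* Only the empty set is negligible for the counting measure, so no quotient by
   almost-everywhere equality is needed; ell_normE gives the norm as a series. *)
Definition ell := LfunType (@counting nat R) p1e.

HB.instance Definition _ := GRing.Lmodule.on ell.

Definition ell_norm (x : ell) : R := fine (Lnorm counting p%:E (EFin \o x)).

Lemma ell_normE (x : ell) :
  (ell_norm x)%:E = ((\sum_(k <oo) (`|x k| `^ p)%:E) `^ p^-1)%E.
Proof.
by rewrite /ell_norm finite_norm_fine Lnorm_counting ?(lt_le_trans ltr01).
Qed.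

Lemma ell_normD (x y : ell) : ell_norm (x + y) <= ell_norm x + ell_norm y.
Proof. exact: ler_LnormD. Qed.

Lemma ell_normZ (a : R) (x : ell) : ell_norm (a *: x) = `|a| * ell_norm x.
Proof.
apply: EFin_inj; rewrite EFinM /ell_norm !finite_norm_fine.
exact: LnormZ.
Qed.

Lemma ell_norm_ge_coord (x : ell) (k : nat) : `|x k| <= ell_norm x.
Proof.
have p0 : 0 < p by rewrite (lt_le_trans ltr01).
rewrite -lee_fin ell_normE.
have -> : (`|x k|%:E = (`|x k| `^ p)%:E `^ p^-1)%E.
  by rewrite poweR_EFin -powRrM mulfV ?gt_eqF// powRr1.
rewrite gt0_ler_poweR ?invr_ge0 ?in_itv/= ?leey ?andbT ?lee_fin ?powR_ge0//.
- exact: ltW.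
- by apply: nneseries_ge0 => n _ _; rewrite lee_fin powR_ge0.
- rewrite (@nneseriesD1 _ (fun k => (`|x k| `^ p)%:E) k)//.
  by rewrite leeDl// nneseries_ge0// => n _ _; rewrite lee_fin powR_ge0.
Qed.

Lemma ell_norm_eq0 (x : ell) : ell_norm x = 0 -> x = 0.
Proof.
move=> x0; apply/val_inj/funext => k; apply/eqP.
by rewrite -normr_le0 -x0; exact: ell_norm_ge_coord.
Qed.

HB.instance Definition _ :=
  Lmodule_isNormed.Build R ell ell_normD ell_normZ ell_norm_eq0.

Lemma ell_unit_subproof (k : nat) :
  (fun j : nat => (j == k)%:R : R) \in Lfun counting p%:E.
Proof.
have p0 : 0 < p by rewrite (lt_le_trans ltr01).
rewrite inE; apply/andP; split; rewrite inE //=.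
rewrite /finite_norm Lnorm_counting// poweR_lty//.
rewrite (@nneseriesD1 _ _ k)//=.
rewrite eseries0 ?adde0 ?poweR_EFin ?ltry// => j _ /negbTE jk.
by rewrite jk normr0 powR0// gt_eqF.
Qed.

Definition ell_unit (k : nat) : ell := Lfun_Sub p1e (ell_unit_subproof k).

(* Coordinates of f under the identification of the dual of l_p with l_q:
   f(x) = \sum_k f(e_k) x_k, see dual_ellE. *)
Definition coord (f : dual ell) (k : nat) : R := f (ell_unit k).

Lemma dual_ellE (f : dual ell) (x : ell) :
  (fun n => \sum_(k < n) coord f k * x k) @ \oo --> f x.
Proof.
have p0 : 0 < p by rewrite (lt_le_trans ltr01).
pose s n : ell := \sum_(k < n) x k *: ell_unit k.
have sE n j : (s n : nat -> R) j = if (j < n)%N then x j else 0.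
  elim: n => [|n IH]; first by rewrite /s big_ord0.
  rewrite /s big_ord_recr/= -/(s n).
  rewrite [LHS](_ : _ = s n j + x n * (j == n)%:R)// IH ltnS (leq_eqVlt j).
  have [->|jn] := eqVneq j n; first by rewrite ltnn add0r mulr1.
  by rewrite mulr0 addr0.
have -> : (fun n => \sum_(k < n) coord f k * x k) = f \o s.
  apply/funext => n; rewrite /= /s linear_sum; apply: eq_bigr => k _.
  by rewrite linearZ /= mulrC.
suff sx : s @ \oo --> x by apply: continuous_cvg => //; exact: dual_continuous.
have nonneg k : (0 <= (`|x k| `^ p)%:E)%E by rewrite lee_fin powR_ge0.
have finx : (\sum_(k <oo) (`|x k| `^ p)%:E < +oo)%E.
  apply: (@lty_poweRy _ _ p^-1); first by rewrite gt_eqF// invr_gt0.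
  by rewrite -ell_normE ltry.
have tailE n : ((ell_norm (x - s n))%:E =
    (\sum_(n <= k <oo) (`|x k| `^ p)%:E) `^ p^-1)%E.
  rewrite ell_normE; congr poweR.
  rewrite (nneseries_split _ n); last by move=> k _; rewrite lee_fin powR_ge0.
  rewrite add0n big1_seq ?add0e; last first.
    move=> k /andP[_]; rewrite mem_index_iota => /andP[_ kn].
    rewrite [(x - s n : ell) k](_ : _ = x k - s n k)// sE kn subrr.
    by rewrite normr0 powR0// gt_eqF.
  apply: congr_lim; apply/funext => m; apply: eq_big_nat => k /andP[nk _].
  by rewrite [(x - s n : ell) k](_ : _ = x k - s n k)// sE ltnNge nk subr0.
apply/cvgrPdist_lt => e e0.
have ep0 : (0 < (e `^ p)%:E)%E by rewrite lte_fin powR_gt0.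
have := @nneseries_tail_cvg _ _ xpredT finx (fun k _ => nonneg k).
move=> /(_ [set y | y < (e `^ p)%:E]%E) [].
  exact: (open_ereal_lt' ep0).
move=> N _ HN; exists N => // n /= Nn.
rewrite [ltLHS](_ : _ = ell_norm (x - s n))// -lte_fin tailE.
have -> : (e%:E = (e `^ p)%:E `^ p^-1)%E.
  by rewrite poweR_EFin -powRrM mulfV ?gt_eqF// powRr1// ltW.
have /= := HN _ Nn.
have : (0 <= \sum_(n <= k <oo) (`|x k| `^ p)%:E)%E by exact: nneseries_ge0.
case: (\sum_(n <= k <oo) _)%E => [t| |]//.
rewrite !lee_fin !lte_fin => t0 te.
by rewrite gt0_ltr_powR ?invr_gt0 ?nnegrE ?powR_ge0.
Qed.

Definition at_most_two_components (f : dual ell) : Prop :=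
  ([set k | coord f k != 0] #<= `I_2)%card.

End ell_p.

Arguments ell {R p} p1.
Arguments ell_unit {R p} p1 k.

(* Main.v *)
From HB Require Import structures.
Require Import Defs.
From mathcomp Require Import all_boot all_order all_algebra.
From mathcomp Require Import all_classical all_reals all_analysis.
From mathcomp Require Import ring lra.
Import Order.TTheory GRing.Theory Num.Theory.
Import numFieldNormedType.Exports.
Import Defs.
Local Open Scope classical_set_scope.
Local Open Scope ring_scope.

(** Put [q = p / (p - 1)], [r = q - 1 = (p - 1)^-1], let [W] be the annihilator
    of [Y], a subspace of [l_q] of dimension [n], and let
    [J x = sgn x |x| ^ r] act coordinatewise.  The tangent line inequality for
    [|x| ^ q] says that [u] is strictly shorter than [u + h] for every [h <> 0]
    in [W] as soon as [J u] annihilates [W] ([norm_lt_orthogonal]).  So the only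
    candidate for the complement [G] of [W] is the set of all [u] with [J u] in
    [W]^perp, and property (SU) amounts to the linearity of this set.

    If [W] is spanned by vectors [a] with at most two components, then
    [J (u_k) a_k + J (u_l) a_l = 0] is equivalent, because [J] is multiplicative
    and bijective, to the linear equation [J' (a_k) u_k + J' (a_l) u_l = 0],
    where [J'], the inverse of [J], is the signed power of exponent [p - 1].
    Thus [G] is cut out by [n] continuous functionals; it meets [W] in [0] by
    the strict inequality, and it complements [W] because an injective square
    matrix is invertible ([two_components_property_SU]).

    Conversely, row reduction provides a basis [b] of [W] with pivot coordinates
    [k_1, ..., k_n], that is [b^i_(k_j) = delta_ij] ([pivot_basis]).  For
    scalars [s] and [t] and two coordinates [j <> l] that are not pivots, let
    [u(s, t)] have the components [s] at [j] and [t] at [l], and let its pivot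
    components be chosen so that [J u(s, t)] annihilates [W]: the one at [k_i]
    is [- J' (J s b^i_j + J t b^i_l)].  These vectors lie in [G].  As [G]
    contains no nonzero vector supported on the pivots
    ([first_order_disjoint]), [u(s, t)] is linear in [(s, t)].  If [b^i_j] and [b^i_l] were both nonzero,
    suitable [s] and [t] would give [J' (1 + 1) = 1 + 1], which forces [p = 2].
    Hence [b^i] has at most one nonzero component outside its pivot
    ([property_SU_pivot]).

    That [W] has dimension [n] uses that [Y] is closed: adding finitely many
    lines to a closed subspace leaves it closed, and this makes the coefficient
    functionals of a complement of [Y] continuous ([annihilator_basis]). *)

Set Implicit Arguments.
Unset Strict Implicit.
Unset Printing Implicit Defensive.

#[local] Arguments coord : simpl never.

(** * Signed powers *)

Section signed_power.
Context {R : realType}.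
Implicit Types r x y h : R.

(** For [r = q - 1] this is [1/q] times the derivative of [|x| ^ q], and,
    applied coordinatewise, the duality map from [l_q] to [l_p]. *)
Definition spow r x : R := Num.sg x * `|x| `^ r.

Lemma spow0 r : spow r 0 = 0.
Proof. by rewrite /spow sgr0 mul0r. Qed.

Lemma spow1 r : spow r 1 = 1.
Proof. by rewrite /spow sgr1 normr1 powR1 mulr1. Qed.

Lemma spowN r x : spow r (- x) = - spow r x.
Proof. by rewrite /spow sgrN normrN mulNr. Qed.

Lemma spowM r x y : spow r (x * y) = spow r x * spow r y.
Proof. by rewrite /spow sgrM normrM powRM// mulrACA. Qed.

Lemma normr_spow r x : 0 < r -> `|spow r x| = `|x| `^ r.
Proof.
move=> r0; have [->|x0] := eqVneq x 0.
  by rewrite spow0 normr0 powR0 ?gt_eqF.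
by rewrite /spow normrM normr_sg x0 mul1r ger0_norm ?powR_ge0.
Qed.

Lemma spow_neq0 r x : x != 0 -> spow r x != 0.
Proof.
by move=> x0; rewrite mulf_neq0 ?sgr_eq0// gt_eqF// powR_gt0// normr_gt0.
Qed.

Lemma spowV r x : x != 0 -> spow r x^-1 = (spow r x)^-1.
Proof.
move=> x0; apply: (mulfI (spow_neq0 r x0)).
by rewrite -spowM !mulfV ?spow1 ?spow_neq0.
Qed.

Lemma spowK r x : 0 < r -> spow r^-1 (spow r x) = x.
Proof.
move=> r0; have [->|x0] := eqVneq x 0; first by rewrite !spow0.
rewrite {1}/spow normr_spow// -powRrM mulfV ?gt_eqF// powRr1//.
rewrite /spow sgrM sgr_id (gtr0_sg (powR_gt0 _ _)) ?normr_gt0// mulr1.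
exact: esym (numEsg x).
Qed.

Lemma spow_mulr r x : 0 < r -> spow r x * x = `|x| `^ (1 + r).
Proof.
move=> r0; have [->|x0] := eqVneq x 0.
  by rewrite mulr0 normr0 powR0// gt_eqF// addr_gt0.
rewrite powRD ?normr_eq0 ?x0 ?implybT// powRr1// /spow mulrAC; congr (_ * _).
exact: esym (normrEsg x).
Qed.

Lemma powR_div r x y : 0 <= x -> 0 < y -> (x / y) `^ r = x `^ r / y `^ r.
Proof.
move=> x0 y0; have yr0 : y `^ r != 0 by rewrite gt_eqF// powR_gt0.
apply: (mulIf yr0); rewrite mulfVK// -powRM ?divr_ge0 ?(ltW y0)//.
by rewrite mulfVK// gt_eqF.
Qed.

(** Bernoulli's inequality in its strict form.  With [y = exp z] and after
    division by [y] it reads [exp (r z) + r exp (- z) > 1 + r], the sum of two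
    instances of [exp t > 1 + t]. *)
Lemma powR_bernoulli_lt r (y : R) : 0 < r -> y != 1 ->
  1 + (1 + r) * (y - 1) < `|y| `^ (1 + r).
Proof.
move=> r0 y1; have [y0|y0] := leP y 0.
  apply: lt_le_trans (powR_ge0 _ _).
  by nra.
have -> : `|y| `^ (1 + r) = expR ((1 + r) * ln y).
  by rewrite gtr0_norm// /powR gt_eqF.
have z0 : ln y != 0 by rewrite ln_eq0.
rewrite -{1}(lnK (x := y)) ?posrE//; move: (ln y) z0 => z z0.
have zr0 : r * z != 0 by rewrite mulf_neq0 // gt_eqF.
have Nz0 : - z != 0 by rewrite oppr_eq0.
have e1 := expR_gt1Dx zr0; have e2 := expR_gt1Dx Nz0.
have -> : expR ((1 + r) * z) = expR z * expR (r * z).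
  by rewrite -expRD; congr expR; ring.
have ez : expR z * expR (- z) = 1 by rewrite -expRD subrr expR0.
have a0 := expR_gt0 z.
have : expR z * (1 + r) < expR z * (expR (r * z) + r * expR (- z)).
  by rewrite ltr_pM2l//; nra.
rewrite (_ : expR z * (_ + _ * _) =
  expR z * expR (r * z) + r * (expR z * expR (- z))); last by ring.
by rewrite ez; lra.
Qed.

(** For [x = 1] this is Bernoulli's inequality, and both sides are homogeneous
    in [(x, h)]; for [x = 0] the left-hand side vanishes. *)
Lemma powR_tangent_lt r x h : 0 < r -> h != 0 ->
  `|x| `^ (1 + r) + (1 + r) * (spow r x * h) < `|x + h| `^ (1 + r).
Proof.
move=> r0 h0; have r10 : 1 + r != 0 by rewrite gt_eqF// addr_gt0.
have [->|x0] := eqVneq x 0.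
  rewrite spow0 mul0r mulr0 normr0 powR0// !add0r.
  by rewrite powR_gt0// normr_gt0.
have := powR_bernoulli_lt (y := (x + h) / x) r0.
have -> : (x + h) / x - 1 = h / x by rewrite mulrDl mulfV// addrC addKr.
rewrite -subr_eq0.
have -> : (x + h) / x - 1 = h / x by rewrite mulrDl mulfV// addrC addKr.
rewrite mulf_neq0 ?invr_eq0// => /(_ isT).
have p0 : 0 < `|x| `^ (1 + r) by rewrite powR_gt0// normr_gt0.
rewrite -(ltr_pM2l p0) -powRM// -normrM (mulrCA x) mulfV// mulr1.
rewrite mulrDr mulr1 -spow_mulr//.
by rewrite (_ : _ * x * _ = (1 + r) * (spow r x * h))//; field.
Qed.

Lemma powR_tangent_le r x h : 0 < r ->
  `|x| `^ (1 + r) + (1 + r) * (spow r x * h) <= `|x + h| `^ (1 + r).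
Proof.
move=> r0; have [->|h0] := eqVneq h 0; first by rewrite !(mulr0, addr0).
exact/ltW/powR_tangent_lt.
Qed.

Lemma spow2_neq r : r != 1 -> spow r 2 != 2.
Proof.
move=> r1; rewrite /spow gtr0_sg// mul1r gtr0_norm//; apply: contra_neq r1.
move=> /(congr1 (@ln R)); rewrite ln_powR => /eqP; rewrite -subr_eq0.
rewrite -{2}(mul1r (ln 2)) -mulrBl mulf_eq0 subr_eq0 => /orP[/eqP//|].
by rewrite ln_eq0// => /eqP; lra.
Qed.

End signed_power.
(** * The dual of l_p as l_q *)

Section bounded_functional.
Context {R : realType} (X : normedModType R).

Lemma bounded_linear_dual_pred (f : X -> R^o) (M : R) :
  linear f -> (forall x, `|f x| <= M * `|x|) -> f \in @dual_pred R X.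
Proof.
move=> lf fM; rewrite inE /=; split=> //.
pose F := GRing.isLinear.Build R X R^o _ f lf.
pose g : {linear X -> R^o} := HB.pack f F.
have : continuous g.
  apply/bounded_linear_continuous/linear_boundedP.
  exists M; split; first exact: num_real.
  move=> a Ma x; apply: le_trans (fM x) _.
  by rewrite ler_wpM2r// ltW.
by [].
Qed.

Definition bounded_dual (f : X -> R^o) (M : R) (lf : linear f)
    (fM : forall x, `|f x| <= M * `|x|) : dual X :=
  Dual (bounded_linear_dual_pred lf fM).

End bounded_functional.

Section dual_of_ell.
Context {R : realType} {p : R} (p1 : 1 < p).
Notation X := (ell (ltW p1)).
Notation r := ((p - 1)^-1).
Implicit Types (f g h : dual X) (x : X) (c : nat -> R) (N k : nat).

Let p0 : 0 < p. Proof. exact: lt_trans p1. Qed.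
Let r0 : 0 < r. Proof. by rewrite invr_gt0 subr_gt0. Qed.
Let q0 : 0 < 1 + r. Proof. exact: addr_gt0. Qed.

Let conj_pq : p^-1 + (1 + r)^-1 = 1.
Proof.
have p_neq0 : p != 0 by rewrite gt_eqF.
have p1_neq0 : p - 1 != 0 by rewrite gt_eqF ?subr_gt0.
by field; rewrite p1_neq0 subrK. Qed.

Lemma coordD f g k : coord (f + g) k = coord f k + coord g k.
Proof. by []. Qed.

Lemma coordZ a f k : coord (a *: f) k = a * coord f k.
Proof. by []. Qed.

Lemma coord_sum n (F : 'I_n -> dual X) k :
  coord (\sum_i F i) k = \sum_i coord (F i) k.
Proof.
elim/big_rec2: _ => [|i a f _ <-]; first by [].
exact: coordD.
Qed.

Definition fvec N c : X := \sum_(k < N) c k *: ell_unit (ltW p1) k.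

Lemma fvecE N c j : fvec N c j = if (j < N)%N then c j else 0.
Proof.
elim: N => [|N IH]; first by rewrite /fvec big_ord0.
rewrite /fvec big_ord_recr/= -/(fvec N c).
rewrite [LHS](_ : _ = fvec N c j + c N * (j == N)%:R)// IH ltnS (leq_eqVlt j).
have [->|jn] := eqVneq j N; first by rewrite ltnn add0r mulr1.
by rewrite mulr0 addr0.
Qed.

Lemma dual_fvec N c f : f (fvec N c) = \sum_(k < N) c k * coord f k.
Proof. by rewrite linear_sum; apply: eq_bigr => k _; rewrite linearZ. Qed.

Lemma ell_norm_powR x :
  (`|x| `^ p)%:E = (\sum_(k <oo) (`|x k| `^ p)%:E)%E.
Proof.
rewrite -poweR_EFin [`|x|%:E](_ : _ = (ell_norm x)%:E)// ell_normE.
rewrite -poweRrM mulVf ?gt_eqF// poweRe1//.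
by apply: nneseries_ge0 => k _ _; rewrite lee_fin powR_ge0.
Qed.

Lemma fvec_norm N c : `|fvec N c| `^ p = \sum_(k < N) `|c k| `^ p.
Proof.
apply: EFin_inj; rewrite ell_norm_powR (nneseries_split _ N); last first.
  by move=> k _; rewrite lee_fin powR_ge0.
rewrite add0n eseries0 ?adde0; last first.
  by move=> k Nk _; rewrite fvecE ltnNge Nk/= normr0 powR0// gt_eqF.
rewrite big_mkord sumEFin; congr (_%:E); apply: eq_bigr => k _.
by rewrite fvecE ltn_ord.
Qed.

Lemma sum_powR_le_norm N x : \sum_(k < N) `|x k| `^ p <= `|x| `^ p.
Proof.
rewrite -lee_fin ell_norm_powR (nneseries_split _ N); last first.
  by move=> k _; rewrite lee_fin powR_ge0.
rewrite add0n big_mkord sumEFin leeDl//; apply: nneseries_ge0 => k _ _.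
by rewrite lee_fin powR_ge0.
Qed.

(** The functional is tested on its image under the duality map, truncated at
    [N]; there it takes the value [S], while the norm of the test vector is
    [S ^ (1/p)]. *)
Lemma sum_coord_le f N :
  \sum_(k < N) `|coord f k| `^ (1 + r) <= `|f| `^ (1 + r).
Proof.
set S := \sum_(k < N) _.
pose x := fvec N (fun k => spow r (coord f k)).
have fx : f x = S.
  by rewrite dual_fvec; apply: eq_bigr => k _; rewrite spow_mulr.
have xp : `|x| `^ p = S.
  rewrite fvec_norm; apply: eq_bigr => k _.
  rewrite normr_spow// -powRrM; congr (_ `^ _).
  by field; rewrite gt_eqF ?subr_gt0.
have S0 : 0 <= S by apply: sumr_ge0 => k _; exact: powR_ge0.
have [->|Sn0] := eqVneq S 0; first exact: powR_ge0.
have Sp : 0 < S by rewrite lt0r Sn0.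
have xE : `|x| = S `^ p^-1 by rewrite -xp -powRrM mulfV ?gt_eqF// powRr1.
have : S <= `|f| * S `^ p^-1.
  by rewrite -{1}fx -xE (le_trans (ler_norm _))//; exact: ler_opnorm.
rewrite -ler_pdivrMr ?powR_gt0// => Sf.
have SE : S `^ (1 + r)^-1 = S / S `^ p^-1.
  apply: (mulIf (lt0r_neq0 (powR_gt0 p^-1 Sp))).
  rewrite mulfVK ?gt_eqF ?powR_gt0// -powRD ?Sn0 ?implybT//.
  by rewrite addrC conj_pq powRr1.
have S1 : S = (S `^ (1 + r)^-1) `^ (1 + r).
  by rewrite -powRrM mulVf ?gt_eqF// powRr1.
rewrite [leLHS]S1 SE.
by rewrite ge0_ler_powR ?nnegrE ?divr_ge0 ?powR_ge0// ltW.
Qed.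

(** Hoelder's inequality for the partial sums, obtained from Young's inequality
    after normalisation. *)
Lemma norm_le_sum_coord f M : 0 <= M ->
  (forall N, \sum_(k < N) `|coord f k| `^ (1 + r) <= M) ->
  `|f| `^ (1 + r) <= M.
Proof.
move=> M0 fM; pose A := M `^ (1 + r)^-1.
have AE : A `^ (1 + r) = M by rewrite -powRrM mulVf ?gt_eqF// powRr1.
rewrite -AE ge0_ler_powR ?nnegrE ?powR_ge0 ?(ltW q0)//.
apply: opnorm_le => [|x]; first exact: powR_ge0.
(* The slack [e] keeps both normalising factors positive. *)
have H e : 0 < e -> `|f x| <= (A + e) * (`|x| + e).
  move=> e0; set a := A + e; set b := `|x| + e.
  have a0 : 0 < a by rewrite ltr_wpDl ?powR_ge0.
  have b0 : 0 < b by rewrite ltr_wpDl.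
  have hol N : `|\sum_(k < N) coord f k * x k| <= a * b.
    rewrite (le_trans (ler_norm_sum _ _ _))//.
    rewrite -[leRHS]mulr1 -ler_pdivrMl ?mulr_gt0// mulr_sumr.
    pose u k := `|coord f k| / a; pose v k := `|x k| / b.
    have uv k : (a * b)^-1 * `|coord f k * x k| <=
        u k `^ (1 + r) / (1 + r) + v k `^ p / p.
      rewrite (_ : (a * b)^-1 * _ = u k * v k).
        apply: conjugate_powR; rewrite ?divr_ge0 ?(ltW a0) ?(ltW b0)//.
        by rewrite addrC.
      by rewrite normrM invfM /u /v; ring.
    apply: (@le_trans _ _ (\sum_(k < N)
      (u k `^ (1 + r) / (1 + r) + v k `^ p / p))).
      by apply: ler_sum => k _; exact: uv.
    rewrite big_split/= -!mulr_suml -[leRHS]conj_pq addrC lerD//.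
      rewrite -[leRHS]mul1r ler_wpM2r ?invr_ge0 ?(ltW p0)//.
      rewrite (_ : \sum_(k < N) _ = (\sum_(k < N) `|x k| `^ p) / b `^ p).
        rewrite ler_pdivrMr ?powR_gt0// mul1r.
        rewrite (le_trans (sum_powR_le_norm N x))//.
        by rewrite ge0_ler_powR ?nnegrE ?(ltW p0) ?(ltW b0)// lerDl ltW.
      rewrite mulr_suml; apply: eq_bigr => k _.
      by rewrite powR_div.
    rewrite -[leRHS]mul1r ler_wpM2r ?invr_ge0 ?(ltW q0)//.
    rewrite (_ : \sum_(k < N) _ =
        (\sum_(k < N) `|coord f k| `^ (1 + r)) / a `^ (1 + r)).
      rewrite ler_pdivrMr ?powR_gt0// mul1r.
      rewrite (le_trans (fM N))// -[leLHS]AE.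
      by rewrite ge0_ler_powR ?nnegrE ?(ltW q0) ?(ltW a0) ?powR_ge0// lerDl ltW.
    rewrite mulr_suml; apply: eq_bigr => k _.
    by rewrite powR_div.
  have cf := cvg_norm (@dual_ellE R p (ltW p1) f x).
  apply: (cvgr_to_le (cf _)).
  by near=> N; exact: hol.
apply/ler_addgt0Pr => e e0; set b := A + `|x| + 1.
have b0 : 0 < b by rewrite ltr_wpDl ?addr_ge0 ?powR_ge0.
have eb0 : 0 < e / b by rewrite divr_gt0.
have d0 : 0 < Num.min 1 (e / b) by rewrite lt_min ltr01.
apply: le_trans (H _ d0) _; set d := Num.min _ _ in d0 *.
have d1 : d <= 1 by rewrite ge_min lexx.
have : d * b <= e by rewrite -ler_pdivlMr// ge_min lexx orbT.
rewrite /b; nra.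
Unshelve. all: by end_near.
Qed.

End dual_of_ell.

(** * Best approximation in l_q *)

Section orthogonality.
Context {R : realType} {p : R} (p1 : 1 < p).
Notation X := (ell (ltW p1)).
Notation r := ((p - 1)^-1).
Implicit Types (f g h u v w : dual X) (c : nat -> R) (N k : nat).

Let r0 : 0 < r. Proof. by rewrite invr_gt0 subr_gt0. Qed.
Let q0 : 0 < 1 + r. Proof. exact: addr_gt0. Qed.

Lemma coord_functional_linear k : linear (fun x : X => x k : R^o).
Proof. by []. Qed.

Lemma coord_functional_bounded k (x : X) : `|x k| <= 1 * `|x|.
Proof. by rewrite mul1r; exact: ell_norm_ge_coord. Qed.

Definition coord_functional k : dual X :=
  bounded_dual (coord_functional_linear k) (coord_functional_bounded k).

Lemma dual_eq0 f : (forall k, coord f k = 0) -> f = 0.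
Proof.
move=> f0; apply/eqP; rewrite -normr_eq0; apply/eqP.
have : `|f| `^ (1 + r) <= 0.
  apply: norm_le_sum_coord => // N.
  by rewrite big1// => k _; rewrite f0 normr0 powR0// gt_eqF.
rewrite le_eqVlt ltNge powR_ge0 orbF powR_eq0.
by case/andP=> /eqP.
Qed.

Lemma exists_coord_neq0 f : f != 0 -> exists k, coord f k != 0.
Proof.
apply: contra_neqP => /forallNP f0; apply: dual_eq0 => k.
by apply/eqP/negPn/negP/f0.
Qed.

Lemma sum_ord_le (F : nat -> R) N N' : (forall k, 0 <= F k) -> (N <= N')%N ->
  \sum_(k < N) F k <= \sum_(k < N') F k.
Proof.
move=> F0 NN'; rewrite (big_ord_widen _ _ NN') big_mkcond ler_sum//= => k _.
by case: ifP.
Qed.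

(** Summing the tangent line inequality at [u] in the direction [h] makes the
    linear term vanish; one coordinate where [h] is nonzero contributes a fixed
    positive gap, so the inequality stays strict in the limit. *)
Lemma norm_lt_orthogonal u h N0 : h != 0 ->
  (forall N, (N0 <= N)%N ->
    \sum_(k < N) spow r (coord u k) * coord h k = 0) ->
  `|u| < `|u + h|.
Proof.
move=> /exists_coord_neq0[k0 hk0] uh.
suff : `|u| `^ (1 + r) < `|u + h| `^ (1 + r).
  rewrite !ltNge; apply: contra => le_norm.
  by rewrite ge0_ler_powR ?nnegrE ?normr_ge0 ?(ltW q0).
pose gap k := `|coord (u + h) k| `^ (1 + r) -
  (`|coord u k| `^ (1 + r) + (1 + r) * (spow r (coord u k) * coord h k)).
have gap_ge0 k : 0 <= gap k by rewrite subr_ge0 powR_tangent_le.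
have gap_gt0 : 0 < gap k0 by rewrite subr_gt0 powR_tangent_lt.
have sum_le N : \sum_(k < N) `|coord u k| `^ (1 + r) <=
    `|u + h| `^ (1 + r) - gap k0.
  pose N' := (N + N0 + k0.+1)%N.
  have NN' : (N <= N')%N by rewrite /N' -addnA leq_addr.
  have powu_ge0 k : 0 <= `|coord u k| `^ (1 + r) by exact: powR_ge0.
  apply: le_trans (sum_ord_le powu_ge0 NN') _.
  rewrite lerBrDr (le_trans _ (sum_coord_le (u + h) N'))//.
  have k0N' : (k0 < N')%N by rewrite /N' leq_addl.
  have gap_le : gap k0 <= \sum_(k < N') gap k.
    by rewrite (bigD1 (Ordinal k0N'))//= lerDl sumr_ge0.
  rewrite (le_trans (lerD (lexx _) gap_le))// -big_split/=.
  rewrite (eq_bigr (fun k : 'I_N' => `|coord (u + h) k| `^ (1 + r) -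
    (1 + r) * (spow r (coord u k) * coord h k))); last first.
    by move=> k _; rewrite /gap; ring.
  rewrite sumrB -mulr_sumr uh ?mulr0 ?subr0//.
  by rewrite /N' addnAC leq_addl.
apply: (@le_lt_trans _ _ (`|u + h| `^ (1 + r) - gap k0)); last first.
  by rewrite ltrBlDr ltrDl.
by apply: norm_le_sum_coord => //; have := sum_le 0%N; rewrite big_ord0.
Qed.

(** Replacing [v] by [v - t w] lowers the part carried by the support of [v] to
    first order in [t], and adds only a term of order [t ^ q] elsewhere. *)
Lemma first_order_disjoint v w :
  (forall k, coord v k != 0 -> coord w k = coord v k) ->
  (forall t : R, `|v| <= `|v - t *: w|) -> v = 0.
Proof.
move=> wv vmin; apply/eqP/contraT => v0.
have A0 : 0 < `|v| `^ (1 + r) by rewrite powR_gt0// normr_gt0.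
have B0 : 0 <= `|w| `^ (1 + r) by exact: powR_ge0.
set A := _ `^ _ in A0; set B := _ `^ _ in B0.
(* This [t] satisfies [t ^ (q - 1) * B < A]. *)
pose s := A / (A + B); pose t := s `^ r^-1.
have AB0 : 0 < A + B by rewrite ltr_wpDr.
have s0 : 0 < s by rewrite divr_gt0.
have s1 : s <= 1 by rewrite ler_pdivrMr// mul1r lerDl.
have sB : s * B < A.
  by rewrite /s mulrAC ltr_pdivrMr// ltr_pM2l// ltrDr.
have t0 : 0 < t by rewrite powR_gt0.
have powR_le1 a b : 0 <= a <= 1 -> 0 <= b -> a `^ b <= 1 :> R.
  move=> /andP[a0 a1] b0; have -> : 1 = 1 `^ b :> R by rewrite powR1.
  by rewrite ge0_ler_powR ?nnegrE ?ler01.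
have t1 : t <= 1.
  by rewrite powR_le1 ?s1 ?ltW// invr_gt0.
have tr : t `^ r = s by rewrite -powRrM mulVf ?gt_eqF// powRr1// ltW.
have powq (a : R) : 0 <= a -> a `^ (1 + r) = a * a `^ r.
  move=> a0; have [->|an0] := eqVneq a 0; first by rewrite mul0r powR0// gt_eqF.
  by rewrite powRD ?an0 ?implybT// powRr1.
have t10 : 0 <= 1 - t by rewrite subr_ge0.
have ts0 : 0 <= t * s by rewrite mulr_ge0 ?(ltW t0) ?(ltW s0).
clearbody t; clearbody s.
have : `|v - t *: w| `^ (1 + r) <= (1 - t) * A + t * s * B.
  apply: norm_le_sum_coord => [|N].
    by rewrite addr_ge0 ?(mulr_ge0 t10 (ltW A0)) ?(mulr_ge0 ts0 B0).
  apply: (@le_trans _ _ ((1 - t) * (\sum_(k < N) `|coord v k| `^ (1 + r)) +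
    t * s * (\sum_(k < N) `|coord w k| `^ (1 + r)))); last first.
    by rewrite (lerD (ler_wpM2l t10 (sum_coord_le v N))
      (ler_wpM2l ts0 (sum_coord_le w N))).
  rewrite !mulr_sumr -big_split/= ler_sum// => k _.
  rewrite [coord (v - _) k](_ : _ = coord v k - t * coord w k)//.
  have [vk|/wv wk] := eqVneq (coord v k) 0.
    rewrite vk sub0r normrN normr0 powR0 ?gt_eqF// mulr0 add0r.
    by rewrite normrM powRM// gtr0_norm// powq ?(ltW t0)// tr.
  rewrite wk -{1}(mul1r (coord v k)) -mulrBl normrM powRM// ger0_norm//.
  rewrite -[leLHS]addr0 lerD//.
    rewrite ler_wpM2r ?powR_ge0// powq// ler_piMr//.
    by rewrite powR_le1 ?t10 ?gerBl ?(ltW r0) ?(ltW t0).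
  by rewrite mulr_ge0 ?powR_ge0.
have : A <= `|v - t *: w| `^ (1 + r).
  by rewrite ge0_ler_powR ?nnegrE ?normr_ge0 ?(ltW q0).
move=> Av vA; suff : (1 - t) * A + t * s * B < A.
  by rewrite ltNge (le_trans Av vA).
by rewrite mulrBl mul1r -addrA gtrDl addrC subr_lt0 -mulrA ltr_pM2l.
Qed.

End orthogonality.

(** * Closed subspaces of finite codimension *)

Section finite_codimension.
Context {R : realType} (X : normedModType R).
Implicit Types (Y Z : set X) (x y z v : X) (f g : dual X).

Lemma subspaceB Y x y : linear_subspace Y -> Y x -> Y y -> Y (x - y).
Proof. by move=> [_ YD] Yx Yy; rewrite addrC -scaleN1r; exact: YD. Qed.

Lemma subspaceZ Y a x : linear_subspace Y -> Y x -> Y (a *: x).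
Proof. by move=> [Y0 YD] Yx; rewrite -[_ *: _]addr0; exact: YD. Qed.

Lemma dual_sumE n (F : 'I_n -> dual X) x : (\sum_i F i) x = \sum_i F i x.
Proof. by elim/big_rec2: _ => [|i a f _ <-]. Qed.

Lemma closed_approx (A : set X) x : closed A ->
  (forall e : R, 0 < e -> exists2 a, A a & `|x - a| < e) -> A x.
Proof.
move=> cA xA; apply: cA => B /nbhs_ballP[e /= e0 eB].
have [a Aa xa] := xA e e0.
by exists a; split=> //; apply: eB; rewrite -ball_normE.
Qed.

Lemma approx_closed (A : set X) :
  (forall x, (forall e : R, 0 < e -> exists2 a, A a & `|x - a| < e) -> A x) ->
  closed A.
Proof.
move=> AP x Ax; apply: AP => e e0.
have [a [Aa xa]] := Ax _ (nbhsx_ballx x e e0).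
by exists a => //; move: xa; rewrite -ball_normE.
Qed.

(** The coefficient along [v] is a bounded functional on [Y + R v], because [v]
    has positive distance to [Y]. *)
Lemma dist_line_gt0 Y v : closed_subspace Y -> ~ Y v ->
  exists2 d : R, 0 < d & forall t x, Y (x - t *: v) -> `|t| * d <= `|x|.
Proof.
move=> [cY sY] Yv.
have [d d0 vd] : exists2 d : R, 0 < d & forall y, Y y -> d <= `|v - y|.
  apply: contrapT => H; apply: Yv; apply: closed_approx cY _ => e e0.
  apply: contrapT => He; apply: H; exists e => // y Yy.
  by rewrite leNgt; apply/negP => ye; apply: He; exists y.
exists d => // t x Yx; have [->|t0] := eqVneq t 0.
  by rewrite normr0 mul0r.
have := vd _ (subspaceZ (- t^-1) sY Yx).
rewrite scaleNr opprK scalerBr scalerA mulVf// scale1r addrC subrK normrZ.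
by rewrite normfV ler_pdivlMl ?normr_gt0.
Qed.

Definition add_line Y v : set X := [set x | exists t : R, Y (x - t *: v)].

(** Let [v] be outside [Y].  If points of [Y + R v] approximate [x], then their
    coefficients along [v] form a Cauchy family, and subtracting from [x] the
    limit times [v] leaves a point of the closure of [Y]. *)
Lemma closed_add_line Y v : closed_subspace Y -> closed_subspace (add_line Y v).
Proof.
move=> cY; have [cl sY] := cY; have [Y0 YD] := sY.
split; last first.
  split; first by exists 0; rewrite scale0r subr0.
  move=> a x y [t Yx] [s Yy]; exists (a * t + s).
  rewrite (_ : _ - _ = a *: (x - t *: v) + (y - s *: v)); first exact: YD.
  by rewrite scalerDl scalerBr scalerA opprD addrACA.
have [Yv|Yv] := pselect (Y v).
  suff -> : add_line Y v = Y by [].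
  apply/seteqP; split=> [x [t Yx]|x Yx]; last first.
    by exists 0; rewrite scale0r subr0.
  by rewrite -(subrK (t *: v) x) addrC; exact: YD.
have [d d0 dist] := dist_line_gt0 cY Yv.
apply: approx_closed => x xZ.
pose near_coef t e := exists2 z, Y (z - t *: v) & `|x - z| < e * d.
have near_ex e : 0 < e -> exists t, near_coef t e.
  move=> e0; have [|z [t Yz] xz] := xZ (e * d); first by rewrite mulr_gt0.
  by exists t; exists z.
have near_le t e t' e' : near_coef t e -> near_coef t' e' -> t - e <= t' + e'.
  move=> [z Yz xz] [z' Yz' xz'].
  have Yzz : Y ((z - z') - (t - t') *: v).
    rewrite (_ : _ - _ = (z - t *: v) - (z' - t' *: v)).
      exact: subspaceB.
    by rewrite scalerBl !opprB addrACA (addrC (- z')) addrACA addrA addrAC.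
  have zz : `|z - z'| <= (e + e') * d.
    rewrite (_ : z - z' = (x - z') - (x - z)).
      rewrite (le_trans (ler_normB _ _))// addrC mulrDl lerD// ltW//.
    by rewrite opprB [RHS]addrC addrA subrK.
  have := le_trans (dist _ _ Yzz) zz.
  rewrite ler_pM2r// => tt.
  by have := le_trans (ler_norm _) tt; lra.
(* Up to [e], every [e]-approximate coefficient is within reach of every other
   one, so the supremum of the lower estimates [t - e] is their limit. *)
pose S := [set a | exists t e, [/\ 0 < e, near_coef t e & a = t - e]].
have [t1 nt1] := near_ex 1 ltr01.
have S0 : S !=set0 by exists (t1 - 1), t1, 1.
have Sub t e : near_coef t e -> ubound S (t + e).
  by move=> nte _ [t' [e' [e0' nte' ->]]]; exact: near_le.
exists (sup S); apply: closed_approx cl _ => e e0.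
pose e' := e / (2 * (d + `|v|)).
have dv0 : 0 < d + `|v| by rewrite ltr_pwDl.
have e0' : 0 < e' by rewrite divr_gt0// mulr_gt0.
have [t nt] := near_ex e' e0'; have [z Yz xz] := nt.
exists (z - t *: v) => //.
have St : `|t - sup S| <= e'.
  rewrite ler_norml lerBrDr lerBlDr addrC; apply/andP; split.
    by rewrite -lerBrDr opprK; apply: sup_le_ub => //; exact: Sub.
  rewrite -lerBlDl; apply: sup_upper_bound; last by exists t, e'.
  by split=> //; exists (t + e'); exact: Sub.
rewrite (_ : x - sup S *: v - (z - t *: v) = (x - z) + (t - sup S) *: v).
  apply: le_lt_trans (ler_normD _ _) _.
  rewrite normrZ (@lt_le_trans _ _ (e' * d + e' * `|v|))//.
    by rewrite ltr_leD// ler_wpM2r.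
  rewrite -mulrDr /e' invfM !mulrA mulfVK ?gt_eqF// ler_pdivrMr//.
  by rewrite ler_peMr ?(ltW e0)//; lra.
by rewrite scalerBl opprB (addrC (t *: v)) addrACA (addrC (- (_ *: v))).
Qed.

Section span.
Context (n : nat) (v : 'I_n -> X).

(** Coefficients indexed by the whole of ['I_n] and vanishing off [s], so that
    enlarging [s] does not change their type. *)
Definition add_span Y (s : seq 'I_n) : set X :=
  [set x | exists2 c : 'I_n -> R,
     forall i, i \notin s -> c i = 0 & Y (x - \sum_i c i *: v i)].

Lemma add_span_cons Y i s : add_span Y (i :: s) = add_line (add_span Y s) (v i).
Proof.
have upd (c : 'I_n -> R) t : \sum_j (if j == i then c j + t else c j) *: v j =
    \sum_j c j *: v j + t *: v i.
  rewrite (bigD1 i)//= eqxx [in RHS](bigD1 i)//= scalerDl addrAC.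
  congr (_ + _ + _).
  by apply: eq_bigr => j /negbTE ->.
apply/seteqP; split=> [x [c c0 Yc]|x [t [c c0 Yc]]]; last first.
  exists (fun j => if j == i then c j + t else c j).
    move=> j; rewrite inE negb_or => /andP[/negbTE ji js].
    by rewrite ji c0.
  by rewrite upd (addrC (\sum_j _)) opprD addrA.
exists (c i); exists (fun j => if j == i then c j + - c i else c j).
  move=> j js; case: eqVneq => [->|ji]; first by rewrite subrr.
  by rewrite c0// inE negb_or ji.
rewrite upd scaleNr [X in Y X](_ : _ = x - \sum_i c i *: v i)//.
by rewrite opprD opprK addrAC addrA addrK.
Qed.

Lemma closed_add_span Y s : closed_subspace Y -> closed_subspace (add_span Y s).
Proof.
move=> cY; elim: s => [|i s IH].
  suff -> : add_span Y [::] = Y by [].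
  apply/seteqP; split=> [x [c c0]|x Yx].
    by rewrite big1 ?subr0// => i _; rewrite c0 ?scale0r.
  by exists (fun=> 0) => //; rewrite big1 ?subr0// => i _; rewrite scale0r.
by rewrite add_span_cons; exact: closed_add_line.
Qed.

End span.

(** The coefficients of [x] modulo [Y] on the vectors [v_i] are linear in [x].
    They are continuous since [v_i] has positive distance to the closed subspace
    spanned by [Y] and the other [v_j]; they form a basis of the annihilator. *)
Lemma annihilator_basis n Y : closed_subspace Y -> has_codim Y n ->
  exists a : 'I_n -> dual X, is_basis (annihilator Y) a.
Proof.
move=> cY [v [vfree vgen]]; have [_ sY] := cY; have [Y0 YD] := sY.
have [c cE] := choice vgen.
have uniq x (b : 'I_n -> R) :
    Y (x - \sum_i b i *: v i) -> forall i, c x i = b i.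
  move=> Yb i; apply/eqP; rewrite -subr_eq0; apply/eqP.
  apply: (vfree (fun i => c x i - b i)).
  have := subspaceB sY Yb (cE x).
  rewrite opprB addrC -addrA (addrA (- x)) addNr add0r.
  rewrite (_ : _ - _ = \sum_i (c x i - b i) *: v i)// -sumrB.
  by apply: eq_bigr => j _; rewrite scalerBl.
have clin i : linear (fun x => c x i : R^o).
  move=> a x y /=; apply: (uniq _ (fun i => a * c x i + c y i)).
  rewrite (_ : _ - _ = a *: (x - \sum_i c x i *: v i) +
    (y - \sum_i c y i *: v i)); first exact: YD.
  rewrite scalerBr addrACA -opprD; congr (_ - _).
  rewrite scaler_sumr -big_split/=; apply: eq_bigr => j _.
  by rewrite scalerDl scalerA.
have cv i j : c (v i) j = (i == j)%:R.
  apply: (uniq _ (fun j => (i == j)%:R)).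
  rewrite (bigD1 i)//= eqxx scale1r big1 ?addr0 ?subrr// => k.
  by rewrite eq_sym => /negbTE ->; rewrite scale0r.
have cbd i : exists M : R, forall x, `|c x i| <= M * `|x|.
  (* The kernel of the [i]-th coefficient. *)
  pose Z := add_span v Y [seq j <- enum 'I_n | j != i].
  have Zv : ~ Z (v i).
    move=> [b b0 /uniq/(_ i)]; rewrite cv eqxx b0 ?mem_filter ?eqxx//.
    by move/eqP; rewrite oner_eq0.
  have [d d0 dist] := dist_line_gt0 (closed_add_span v _ cY) Zv.
  exists d^-1 => x; rewrite -ler_pdivrMl ?invr_gt0// invrK mulrC.
  apply: dist; exists (fun j => if j == i then 0 else c x j).
    by move=> j; rewrite mem_filter mem_enum andbT negbK => ->.
  rewrite [X in Y X](_ : _ = x - \sum_i c x i *: v i)//.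
  rewrite -addrA -opprD; congr (_ - _); rewrite (bigD1 i)//= eqxx scale0r add0r.
  by rewrite [RHS](bigD1 i)//=; congr (_ + _); apply: eq_bigr => j /negbTE ->.
have [M cM] := choice cbd.
pose a i := bounded_dual (clin i) (cM i).
exists a; split.
- move=> i y Yy; apply: (uniq y (fun=> 0)).
  by rewrite big1 ?subr0// => j _; rewrite scale0r.
- move=> b b0 i; have := congr1 (fun f : dual X => f (v i)) b0.
  rewrite /= dual_sumE (bigD1 i)//= big1 ?addr0 => [|j ji].
    by rewrite [LHS](_ : _ = b i * c (v i) i)// cv eqxx mulr1.
  rewrite [LHS](_ : _ = b j * c (v i) j)// cv eq_sym (negbTE ji).
  by rewrite mulr0.
- move=> w wY; exists (fun i => w (v i)); apply/val_inj/funext => x /=.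
  rewrite dual_sumE; have := wY _ (cE x); rewrite linearB linear_sum /=.
  move=> /eqP; rewrite subr_eq0 => /eqP ->; apply: eq_bigr => i _.
  by rewrite linearZ; exact: mulrC.
Qed.

End finite_codimension.

(** * Two-component bases give property (SU) *)

Section two_components.
Context {R : realType} {p : R} (p1 : 1 < p).
Notation X := (ell (ltW p1)).
Implicit Types (f : dual X) (k l m N : nat).

(** The two indices are kept distinct, even when the support has fewer than two
    elements, so that sums over them split. *)
Lemma two_components_support f : at_most_two_components f ->
  exists k l, k != l /\ forall m, m != k -> m != l -> coord f m = 0.
Proof.
rewrite /at_most_two_components; set A := [set m | _] => A2.
suff [k [l [kl Akl]]] : exists k l, k != l /\ forall m, A m -> m = k \/ m = l.
  exists k, l; split=> // m mk ml; apply/eqP/negPn/negP => fm.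
  by have [/eqP|/eqP] := Akl m fm; apply/negP.
have /pcard_leP[phi] := A2.
have phi2 m : A m -> (phi m < 2)%N by exact: 'funS_phi.
have phiI m m' : A m -> A m' -> phi m = phi m' -> m = m'.
  by move=> Am Am'; apply: 'inj_phi; exact/mem_set.
have [[k Ak]|nA] := pselect (exists k, A k); last first.
  by exists 0%N, 1%N; split=> // m Am; exfalso; apply: nA; exists m.
have [[l [Al lk]]|nl] := pselect (exists l, A l /\ l != k); last first.
  exists k, k.+1; split; first by rewrite neq_ltn ltnSn.
  move=> m Am; left; apply/eqP/negPn/negP => mk; apply: nl; by exists m.
exists k, l; rewrite eq_sym lk; split=> // m Am.
have [pm|pm] := eqVneq (phi m) (phi k); first by left; exact: phiI.
right; apply: (phiI) => //.
have pl : phi l != phi k by apply: contra lk => /eqP/phiI ->.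
move: pm pl (phi2 _ Ak) (phi2 _ Al) (phi2 _ Am).
by case: (phi m) (phi l) (phi k) => [|[|?]] [|[|?]] [|[|?]].
Qed.

Lemma at_most_two_components_support f k l :
  (forall m, coord f m != 0 -> m = k \/ m = l) -> at_most_two_components f.
Proof.
move=> fkl; pose e (i : nat) := if i == 0%N then k else l.
apply: (@card_le_trans _ _ _ [set e i | i in `I_2]); last exact: card_image_le.
apply: subset_card_le => m /= /fkl[->|->]; first by exists 0%N.
by exists 1%N.
Qed.

Lemma sum_two_support (F : nat -> R) k l N : k != l ->
  (k < N)%N -> (l < N)%N -> (forall m, m != k -> m != l -> F m = 0) ->
  \sum_(m < N) F m = F k + F l.
Proof.
move=> kl kN lN F0; rewrite (bigD1 (Ordinal kN))//=; congr (_ + _).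
rewrite (bigD1 (Ordinal lN))/=; last by rewrite -val_eqE/= eq_sym.
by rewrite big1 ?addr0// => m /andP[]; rewrite -!val_eqE/=; exact: F0.
Qed.

End two_components.

Section sufficiency.
Context {R : realType} {p : R} (p1 : 1 < p).
Notation X := (ell (ltW p1)).
Notation r := ((p - 1)^-1).
Implicit Types (f g h : dual X) (k l m N : nat).

Let s0 : 0 < p - 1. Proof. by rewrite subr_gt0. Qed.

(** Signed powers are odd and multiplicative, so they may be applied to both
    sides of an equation between two terms; sums of three terms have no such
    rule. *)
Lemma two_term_duality (a b x y : R) :
  spow (p - 1) a * x + spow (p - 1) b * y = 0 ->
  spow r x * a + spow r y * b = 0.
Proof.
move/eqP; rewrite addr_eq0 => /eqP/(congr1 (spow r)).
rewrite spowN !(spowM r (spow _ _)) !spowK// => H.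
by rewrite mulrC H mulrC addNr.
Qed.

(** The complement [G] is cut out by the vectors [y_i] whose coordinates are the
    signed powers of those of [a_i]. *)
Lemma two_components_property_SU n (Y : set X) (a : 'I_n -> dual X) :
  is_basis (annihilator Y) a -> (forall i, at_most_two_components (a i)) ->
  property_SU Y.
Proof.
move=> [aY afree agen] a2.
have [k /choice[l kl]] := choice (fun i => two_components_support (a2 i)).
pose N0 := (\max_i maxn (k i) (l i)).+1.
have kN i : (k i < N0)%N.
  by rewrite ltnS (leq_trans (leq_maxl _ (l i)))// (leq_bigmax i).
have lN i : (l i < N0)%N.
  by rewrite ltnS (leq_trans (leq_maxr (k i) _))// (leq_bigmax i).
pose y i : X := fvec p1 N0 (fun m => spow (p - 1) (coord (a i) m)).
pose G : set (dual X) := [set g | forall i, g (y i) = 0].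
have orth g h N : G g -> annihilator Y h -> (N0 <= N)%N ->
    \sum_(m < N) spow r (coord g m) * coord h m = 0.
  move=> Gg /agen[c ->] NN.
  have ga i : \sum_(m < N) spow r (coord g m) * coord (a i) m = 0.
    have [kli ai0] := kl i.
    rewrite (@sum_two_support _ (fun m => spow r (coord g m) * coord (a i) m)
      (k i) (l i)) ?(leq_trans _ NN)//; last first.
      by move=> m mk ml; rewrite ai0// mulr0.
    apply: two_term_duality; rewrite -(Gg i) dual_fvec.
    rewrite (@sum_two_support _
      (fun m => spow (p - 1) (coord (a i) m) * coord g m) (k i) (l i))//.
    by move=> m mk ml; rewrite ai0// spow0 mul0r.
  under eq_bigr => m _ do rewrite coord_sum mulr_sumr.
  rewrite exchange_big big1//= => i _.
  under eq_bigr => m _ do rewrite coordZ mulrCA.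
  by rewrite -mulr_sumr ga mulr0.
have strict g h : G g -> annihilator Y h -> h != 0 -> `|g| < `|g + h|.
  by move=> Gg Yh h0; apply: (norm_lt_orthogonal h0) => N; exact: orth.
have annN h : annihilator Y h -> annihilator Y (- h).
  by move=> Yh z Yz; rewrite [LHS](_ : _ = - h z)// Yh ?oppr0.
have GY0 g : G g -> annihilator Y g -> g = 0.
  move=> Gg Yg; apply/eqP/negPn/negP => g0.
  have := strict _ _ Gg (annN _ Yg); rewrite oppr_eq0 subrr normr0.
  by move=> /(_ g0); rewrite normr_lt0.
have annS (c : 'I_n -> R) : annihilator Y (\sum_i c i *: a i).
  move=> z Yz; rewrite dual_sumE big1// => i _.
  by rewrite [LHS](_ : _ = c i * a i z)// aY ?mulr0.
exists G; split; last by move=> f g h Gg Yh h0 ->; exact: strict.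
- split; last first.
    split=> [i|c f g Gf Gg i]; first by [].
    by rewrite [LHS](_ : _ = c * f (y i) + g (y i))// Gf Gg mulr0 addr0.
  apply: approx_closed => g gG i; apply/eqP/negPn/negP => gy.
  have d0 : 0 < `|y i| + 1 by rewrite ltr_wpDl.
  have gy0 : 0 < `|g (y i)| by rewrite normr_gt0.
  have [|g' Gg' gg'] := gG (`|g (y i)| / (`|y i| + 1)); first exact: divr_gt0.
  have : `|(g - g') (y i)| <= `|g - g'| * `|y i| by exact: ler_opnorm.
  rewrite [(g - g') (y i)](_ : _ = g (y i) - g' (y i))// Gg' subr0.
  have : `|g - g'| * `|y i| <= `|g (y i)| / (`|y i| + 1) * `|y i|.
    by rewrite ler_wpM2r// ltW.
  move=> h1 h2; have := le_trans h2 h1.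
  rewrite -mulrA ler_pMr// ler_pdivlMl// mulr1; lra.
- split; first exact: GY0.
  pose M : 'M[R]_n := \matrix_(j, i) a j (y i).
  have ME (c : 'rV[R]_n) i :
      (\sum_j c 0 j *: a j) (y i) = (c *m M) 0 i.
    by rewrite dual_sumE mxE; apply: eq_bigr => j _; rewrite mxE.
  have Munit : M \in unitmx.
    rewrite -row_free_unit; apply: inj_row_free => c cM.
    have c0 : \sum_j c 0 j *: a j = 0.
      by apply: GY0 => [i|]; [rewrite ME cM mxE | exact: annS].
    by apply/rowP => j; rewrite (afree _ c0) mxE.
  move=> f; pose c := (\row_i f (y i)) *m invmx M.
  exists (f - \sum_j c 0 j *: a j), (\sum_j c 0 j *: a j).
  split; [move=> i | exact: annS | by rewrite subrK].
  rewrite [LHS](_ : _ = f (y i) - (\sum_j c 0 j *: a j) (y i))//.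
  by rewrite ME mulmxKV// mxE subrr.
Qed.

End sufficiency.

(** * Property (SU) gives a two-component basis *)

Section necessity.
Context {R : realType} {p : R} (p1 : 1 < p).
Notation X := (ell (ltW p1)).
Notation r := ((p - 1)^-1).
Implicit Types (f g h u v w : dual X) (k l m N : nat).

Let s0 : 0 < p - 1. Proof. by rewrite subr_gt0. Qed.
Let r0 : 0 < r. Proof. by rewrite invr_gt0. Qed.

Lemma sum_coord0_dual_eq0 n (a : 'I_n -> dual X) (c : 'I_n -> R) :
  (forall m, \sum_i c i * coord (a i) m = 0) -> \sum_i c i *: a i = 0.
Proof. by move=> ca; apply: dual_eq0 => m; rewrite coord_sum ca. Qed.

(** The kernels of the truncated coordinate matrices decrease.  Where the rank
    is maximal they become stationary, and a vector in all of them gives a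
    relation between the functionals. *)
Lemma exists_row_free_coords n (a : 'I_n -> dual X) :
  (forall c : 'I_n -> R, \sum_i c i *: a i = 0 -> forall i, c i = 0) ->
  exists N, row_free (\matrix_(i < n, m < N) coord (a i) m).
Proof.
move=> afree; pose A N : 'M[R]_(n, N) := \matrix_(i < n, m < N) coord (a i) m.
have uAE (u : 'rV[R]_n) N : u *m A N = 0 <->
    forall m, (m < N)%N -> \sum_i u 0 i * coord (a i) m = 0.
  split=> [uA m mN|ua].
    have := congr1 (fun B : 'rV_N => B 0 (Ordinal mN)) uA.
    rewrite mxE [RHS]mxE; apply: etrans.
    by apply: eq_bigr => i _; rewrite mxE.
  apply/rowP => m; rewrite mxE [RHS]mxE; apply: etrans (ua m (ltn_ord m)).
  by apply: eq_bigr => i _; rewrite mxE.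
pose P d := `[< exists N, \rank (A N) = d >].
have exP : exists d, P d by exists (\rank (A 0%N)); apply/asboolP; exists 0%N.
have leP d : P d -> (d <= n)%N by move=> /asboolP[N <-]; exact: rank_leq_row.
case: (ex_maxnP exP leP) => d /asboolP[N Nd] dmax; exists N.
rewrite -kermx_eq0; apply/negPn/negP => /rowV0Pn[u /sub_kermxP uA u0].
have uA' M : u *m A M = 0.
  have [MN|/ltnW NM] := leqP M N.
    by apply/uAE => m mM; apply: ((uAE _ _).1 uA); exact: leq_trans MN.
  have kerMN : (kermx (A M) <= kermx (A N))%MS.
    apply/rV_subP => w /sub_kermxP/uAE wM; apply/sub_kermxP/uAE => m mN.
    by apply: wM; exact: leq_trans NM.
  have rankM : (\rank (A M) <= \rank (A N))%N.
    by rewrite Nd; apply: dmax; apply/asboolP; exists M.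
  apply/sub_kermxP; apply: submx_trans (_ : (kermx (A N) <= _)%MS).
    exact/sub_kermxP.
  by rewrite -(mxrank_leqif_sup kerMN) eqn_leq mxrankS// !mxrank_ker leq_sub2l.
move/eqP: u0; apply; apply/rowP => i; rewrite mxE.
apply: (afree (fun i => u 0 i)); apply: sum_coord0_dual_eq0 => m.
by apply: (uAE u m.+1).1 => //; exact: uA'.
Qed.

(** Row reduction: the basis is multiplied by the inverse of an invertible
    [n x n] block of its coordinate matrix. *)
Lemma pivot_basis n (W : set (dual X)) (a : 'I_n -> dual X) :
  linear_subspace W -> is_basis W a ->
  exists (b : 'I_n -> dual X) (k : 'I_n -> nat),
    is_basis W b /\ forall i j, coord (b i) (k j) = (i == j)%:R.
Proof.
move=> [W0 WD] [aW afree agen].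
have [N rfA] := exists_row_free_coords afree.
set A := \matrix_(_, _) _ in rfA.
have rfT : row_full A^T by rewrite /row_full mxrank_tr.
pose S := rowsub (fullrankfun rfT) A^T.
have Sunit : S^T \in unitmx by rewrite unitmx_tr fullrowsub_unit.
pose T := invmx S^T; pose k j : nat := fullrankfun rfT j.
pose b i := \sum_l T i l *: a l.
have bk i j : coord (b i) (k j) = (i == j)%:R.
  have := mulVmx Sunit => /matrixP/(_ i j); rewrite !mxE => <-.
  by rewrite coord_sum; apply: eq_bigr => l _; rewrite !mxE.
have bE (x : 'rV[R]_n) : \sum_i x 0 i *: b i = \sum_l (x *m T) 0 l *: a l.
  under eq_bigr => i _ do rewrite scaler_sumr.
  rewrite exchange_big/=; apply: eq_bigr => l _.
  by rewrite mxE scaler_suml; apply: eq_bigr => i _; rewrite scalerA.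
exists b, k; split=> //; split.
- move=> i; rewrite /b; elim/big_ind: _ => // [f g Wf Wg|l _].
    by rewrite -[f]scale1r; exact: WD.
  by rewrite -[_ *: _]addr0; exact: WD.
- move=> c c0 j; have := congr1 (fun f => coord f (k j)) c0.
  rewrite /= coord_sum (bigD1 j)//= coordZ bk eqxx mulr1 big1 ?addr0//.
  by move=> i ij; rewrite coordZ bk (negbTE ij) mulr0.
- move=> w /agen[c ->]; pose x := (\row_i c i) *m S^T.
  exists (fun i => x 0 i); rewrite bE /x mulmxK//.
  by apply: eq_bigr => l _; rewrite mxE.
Qed.

Definition pivot_combo n (k : 'I_n -> nat) j l (s t : R) (y : 'I_n -> R) :
    dual X :=
  s *: coord_functional p1 j + t *: coord_functional p1 l +
  \sum_i y i *: coord_functional p1 (k i).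

Lemma coord_coord_functional j m :
  coord (coord_functional p1 j) m = (j == m)%:R.
Proof. by []. Qed.

Lemma pivot_comboE n (k : 'I_n -> nat) j l s t y m :
  coord (pivot_combo k j l s t y) m =
  s * (j == m)%:R + t * (l == m)%:R + \sum_i y i * (k i == m)%:R.
Proof.
rewrite !coordD !coordZ coord_sum !coord_coord_functional.
by congr (_ + _).
Qed.

Lemma sum_coord_delta (w : dual X) j N : (j < N)%N ->
  \sum_(m < N) (j == m :> nat)%:R * coord w m = coord w j.
Proof.
move=> jN; rewrite (bigD1 (Ordinal jN))//= eqxx mul1r big1 ?addr0// => m.
by rewrite -val_eqE/= eq_sym => /negbTE ->; rewrite mul0r.
Qed.

Lemma sum_pivot_combo n (k : 'I_n -> nat) j l s t y (w : dual X) N :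
  (j < N)%N -> (l < N)%N -> (forall i, (k i < N)%N) ->
  \sum_(m < N) coord (pivot_combo k j l s t y) m * coord w m =
  s * coord w j + t * coord w l + \sum_i y i * coord w (k i).
Proof.
move=> jN lN kN; under eq_bigr => m _ do rewrite pivot_comboE !mulrDl mulr_suml.
rewrite !big_split/= exchange_big/=; congr (_ + _ + _).
- by under eq_bigr => m _ do rewrite -mulrA; rewrite -mulr_sumr sum_coord_delta.
- by under eq_bigr => m _ do rewrite -mulrA; rewrite -mulr_sumr sum_coord_delta.
- apply: eq_bigr => i _.
  by under eq_bigr => m _ do rewrite -mulrA; rewrite -mulr_sumr sum_coord_delta.
Qed.

Lemma pivot_combo_free n (k : 'I_n -> nat) j l s t y m :
  (forall i, k i != m) ->
  coord (pivot_combo k j l s t y) m = s * (j == m)%:R + t * (l == m)%:R.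
Proof.
move=> km; rewrite pivot_comboE big1 ?addr0// => i _.
by rewrite (negbTE (km i)) mulr0.
Qed.

Lemma pivot_combo_pivot n (k : 'I_n -> nat) j l s t y i :
  injective k -> k i != j -> k i != l ->
  coord (pivot_combo k j l s t y) (k i) = y i.
Proof.
move=> kI kj kl; rewrite pivot_comboE !(eq_sym _ (k i)).
rewrite (negbTE kj) (negbTE kl) !mulr0 !add0r (bigD1 i)//= eqxx mulr1.
rewrite big1 ?addr0// => i' ii'.
by rewrite (inj_eq kI) (negbTE ii') mulr0.
Qed.

(** Powers act coordinatewise, and the coordinate functionals involved are
    distinct, so no coordinate of the combination is a proper sum. *)
Lemma spow_pivot_combo n (k : 'I_n -> nat) j l s t y e m :
  injective k -> j != l -> (forall i, k i != j) -> (forall i, k i != l) ->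
  spow e (coord (pivot_combo k j l s t y) m) =
  coord (pivot_combo k j l (spow e s) (spow e t) (fun i => spow e (y i))) m.
Proof.
move=> kI jl kj kl.
have [/existsP[i /eqP <-]|/existsPn km] := boolP [exists i, k i == m].
  by rewrite !pivot_combo_pivot.
rewrite !pivot_combo_free//; have [<-|jm] := eqVneq j m.
  by rewrite eq_sym (negbTE jl) !mulr1 !mulr0 !addr0.
by rewrite !mulr0 !add0r; case: (l == m); rewrite ?mulr1// !mulr0 spow0.
Qed.

Lemma annihilator_subspace (Y : set X) : linear_subspace (annihilator Y).
Proof.
split=> [y Yy|c f g Yf Yg y Yy]; first by [].
by rewrite [LHS](_ : _ = c * f y + g y)// Yf// Yg// mulr0 addr0.
Qed.

(** If both coordinates were nonzero, linearity of [G] would make the signed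
    power of exponent [p - 1] fix [2], against [p <> 2]. *)
Lemma property_SU_pivot n (Y : set X) (b : 'I_n -> dual X) (k : 'I_n -> nat) :
  p != 2 -> property_SU Y -> is_basis (annihilator Y) b ->
  (forall i j, coord (b i) (k j) = (i == j)%:R) ->
  forall i j l, j != l -> (forall i, k i != j) -> (forall i, k i != l) ->
    coord (b i) j = 0 \/ coord (b i) l = 0.
Proof.
move=> p2 [G [[_ [G0 GD]] [GY0 GYsum] strict]] [bY _ bgen] bk i j l jl kj kl.
have [Y0 YD] := annihilator_subspace Y.
have annN h : annihilator Y h -> annihilator Y (- h).
  by move=> Yh; rewrite -scaleN1r -[_ *: _]addr0; exact: YD.
have kI : injective k.
  move=> i1 i2 k12; have := bk i1 i2; rewrite -k12 bk eqxx.
  by case: eqP => // _ /eqP; rewrite oner_eq0.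
(* Orthogonality makes [u] shorter than [u - h], where [h] is its component in
   the annihilator; property (SU) says the opposite unless [h = 0]. *)
have GofJ u N0 : (forall w N, annihilator Y w -> (N0 <= N)%N ->
    \sum_(m < N) spow r (coord u m) * coord w m = 0) -> G u.
  move=> Ju; have [g [h [Gg Yh uE]]] := GYsum u.
  have [h0|h0] := eqVneq h 0; first by rewrite uE h0 addr0.
  have : `|u| < `|u + - h|.
    apply: (@norm_lt_orthogonal _ _ _ _ _ N0); first by rewrite oppr_eq0.
    by move=> N NN; apply: Ju => //; exact: annN.
  by rewrite uE addrK ltNge (ltW (strict _ _ _ Gg Yh h0 erefl)).
have Gpivot v : G v -> (forall m, coord v m != 0 -> exists i, k i = m) -> v = 0.
  move=> Gv vk; pose w := \sum_i coord v (k i) *: b i.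
  have Yw : annihilator Y w.
    move=> y Yy; rewrite dual_sumE big1// => i' _.
    by rewrite [LHS](_ : _ = coord v (k i') * b i' y)// bY ?mulr0.
  apply: (@first_order_disjoint _ _ _ v w) => [m /vk[i' <-]|t].
    rewrite coord_sum (bigD1 i')//= coordZ bk eqxx mulr1 big1 ?addr0//.
    by move=> i2 /negbTE ii; rewrite coordZ bk ii mulr0.
  have [->|tw0] := eqVneq (t *: w) 0; first by rewrite subr0.
  apply/ltW/(strict _ v (- (t *: w))) => //; last by rewrite oppr_eq0.
  by apply: annN; rewrite -[_ *: _]addr0; exact: YD.
(* The pivot components that make the power of [u s t] annihilate [b_i]. *)
pose F s t i :=
  - spow (p - 1) (spow r s * coord (b i) j + spow r t * coord (b i) l).
pose u s t := pivot_combo k j l s t (F s t).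
pose N0 := (j + l + \max_i k i).+1.
have jN : (j < N0)%N by rewrite ltnS -addnA leq_addr.
have lN : (l < N0)%N by rewrite ltnS addnAC leq_addl.
have kN i' : (k i' < N0)%N.
  by rewrite ltnS (leq_trans (leq_bigmax i'))// leq_addl.
have Gu s t : G (u s t).
  apply: (@GofJ _ N0) => w N /bgen[c ->] NN.
  under eq_bigr => m _.
    rewrite spow_pivot_combo//; over.
  rewrite sum_pivot_combo ?(leq_trans _ NN)//; last first.
    by move=> i'; exact: leq_trans NN.
  rewrite !coord_sum !mulr_sumr.
  under [X in _ + X]eq_bigr => i1 _.
    rewrite coord_sum (bigD1 i1)//= coordZ bk eqxx mulr1 big1 ?addr0.
      over.
    by move=> i2 /negbTE ii; rewrite coordZ bk ii mulr0.
  rewrite -!big_split/= big1// => i1 _.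
  rewrite !coordZ /F spowN spowK//.
  by ring.
have u_free s t m : (forall i', k i' != m) ->
    coord (u s t) m = s * (j == m)%:R + t * (l == m)%:R.
  exact: pivot_combo_free.
have u_pivot s t i' : coord (u s t) (k i') = F s t i'.
  exact: pivot_combo_pivot.
clearbody u.
have [|bj0] := eqVneq (coord (b i) j) 0; first by left.
have [|bl0] := eqVneq (coord (b i) l) 0; first by right.
exfalso.
(* With these scalars the [k_i]-components of [s u(1, 0)] and [t u(0, 1)] are
   both [- 1], and that of [u s t] is [- spow (p - 1) 2]. *)
pose s := (spow (p - 1) (coord (b i) j))^-1.
pose t := (spow (p - 1) (coord (b i) l))^-1.
have sE : spow r s * coord (b i) j = 1.
  by rewrite /s -spowV// spowK// mulVf.
have tE : spow r t * coord (b i) l = 1.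
  by rewrite /t -spowV// spowK// mulVf.
(* [d] lies in [G] and its coordinates off the pivots cancel. *)
have [d Gd dE] : exists2 d, G d & forall m,
    coord d m = s * coord (u 1 0) m + (t * coord (u 0 1) m - coord (u s t) m).
  exists (s *: u 1 0 + (t *: u 0 1 + (- 1) *: u s t)).
    apply: (GD _ _ _ (Gu _ _)); apply: (GD _ _ _ (Gu _ _)).
    by rewrite -[_ *: _]addr0; exact: (GD _ _ _ (Gu _ _)).
  by move=> m; rewrite !coordD !coordZ mulN1r.
have d0 : d = 0.
  apply: Gpivot => // m dm; apply: contrapT => /forallNP km.
  have km' i' : k i' != m by apply/eqP/km.
  move: dm; rewrite dE !u_free//.
  move: (j == m)%:R (l == m)%:R => x z /eqP; apply.
  by ring.
have F10 : s * F 1 0 i = - 1.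
  by rewrite /F spow1 spow0 mul1r mul0r addr0 mulrN mulVf ?spow_neq0.
have F01 : t * F 0 1 i = - 1.
  by rewrite /F spow1 spow0 mul1r mul0r add0r mulrN mulVf ?spow_neq0.
clearbody s t.
have Fst : F s t i = - spow (p - 1) 2 by rewrite /F sE tE.
have := dE (k i); rewrite d0 !u_pivot F10 F01 Fst opprK.
rewrite [coord 0 _](_ : _ = 0)// => /esym/eqP.
rewrite addrA addrC -opprD subr_eq0; apply/negP.
by apply: spow2_neq; rewrite subr_eq.
Qed.

End necessity.

Unset Implicit Arguments.
Set Strict Implicit.
Set Printing Implicit Defensive.

Theorem theorem3p16 (R : realType) (p : R) (p1 : 1 < p) (p2 : p != 2) (n : nat)
    (Y : set (ell (ltW p1))) (Yclosed : closed_subspace Y)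
    (Ycodim : has_codim Y n) :
  property_SU Y <->
  exists a : 'I_n -> dual (ell (ltW p1)),
    is_basis (annihilator Y) a /\ forall i, at_most_two_components (a i).
Proof.
split=> [YSU|[a [abasis a2]]]; last exact: two_components_property_SU abasis a2.
have [a abasis] := annihilator_basis Yclosed Ycodim.
have [b [k [bbasis bk]]] := pivot_basis (annihilator_subspace Y) abasis.
exists b; split=> // i.
have bk0 m i' : k i' = m -> coord (b i) m != 0 -> m = k i.
  by move=> <-; rewrite bk; case: (eqVneq i i') => [->//|]; rewrite eqxx.
have [[l [lk bl]]|nl] :=
    pselect (exists l, (forall i', k i' != l) /\ coord (b i) l != 0);
  last first.
  apply: (@at_most_two_components_support _ _ _ _ (k i) (k i)) => m bm; left.
  have [[i' km]|nk] := pselect (exists i', k i' = m); first exact: bk0 km bm.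
  exfalso; apply: nl; exists m; split=> // i'; apply/eqP => km.
  by apply: nk; exists i'.
apply: (@at_most_two_components_support _ _ _ _ (k i) l) => m bm.
have [[i' km]|nk] := pselect (exists i', k i' = m).
  by left; exact: bk0 km bm.
right; apply/eqP/negPn/negP => ml.
have mk i' : k i' != m by apply/eqP => km; apply: nk; exists i'.
have [/eqP|/eqP] := property_SU_pivot p2 YSU bbasis bk i ml mk lk.
  by rewrite (negbTE bm).
by rewrite (negbTE bl).
Qed.
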